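(* Let $E$ be a Polish space and let $A \subseteq C_b(E)\times C_b(E)$ be a linear operator such that the martingale problem for $A$ is well-posed; for $x\in E$ let $\mathbb{P}_x \in \mathcal{P}(D_E(\mathbb{R}^+))$ be the solution with $X(0)=x$ $\mathbb{P}_x$-almost surely, and assume that $x\mapsto \mathbb{P}_x$ is continuous for the weak topology on $\mathcal{P}(D_E(\mathbb{R}^+))$. Let $H$ be a collection of pairs $(f,g)\in C_b(E)\times C_b(E)$ such that for all $x\in E$ $$t\mapsto \exp\left\{f(X(t))-f(X(0))-\int_0^t g(X(s))\,ds\right\}$$ is a martingale with respect to $\mathcal{F}_t$ under $\mathbb{P}_x$. For $\lambda>0$ and $h\in C_b(E)$ set $$R(\lambda)h(x)=\sup_{\mathbb{Q}\in\mathcal{P}(D_E(\mathbb{R}^+))}\left\{\int_0^\infty\left(\int h(X(t))\,\mathbb{Q}(dX)-S_t(\mathbb{Q}\,|\,\mathbb{P}_x)\right)\tau_\lambda(dt)\right\}.$$ Then for all $\lambda>0$, $x\in E$ and $(f,g)\in H$ we have $R(\lambda)(f-\lambda g)(x)=f(x)$.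
   Context: $C_b(E)$: bounded continuous real functions on $E$. $\mathbb{R}^+=[0,\infty)$. $D_E(\mathbb{R}^+)$: Skorokhod space of right-continuous trajectories $X:\mathbb{R}^+\to E$ with left limits, with the usual Skorokhod topology. $\mathcal{P}(\mathcal{X})$: Borel probability measures on $\mathcal{X}$, with the weak topology. $\mathcal{F}_t=\sigma(X(s)\,|\,s\le t)$ on $D_E(\mathbb{R}^+)$. Martingale problem: for $\nu\in\mathcal{P}(E)$, $\mathbb{P}\in\mathcal{P}(D_E(\mathbb{R}^+))$ solves the martingale problem for $(A,\nu)$ if $\mathbb{P}\circ X(0)^{-1}=\nu$ and for all $f$ in the domain of $A$ the process $f(X(t))-f(X(0))-\int_0^t Af(X(s))\,ds$ is a martingale for $(\mathcal{F}_t)$ under $\mathbb{P}$. It is well-posed if there is exactly one solution for every $\nu\in\mathcal{P}(E)$. Relative entropy: $S(\nu\,|\,\mu)=\int\log\frac{d\nu}{d\mu}\,d\nu$ if $\nu\ll\mu$, and $+\infty$ otherwise; $S_t(\mathbb{Q}\,|\,\mathbb{P})$ is the relative entropy of the restrictions of $\mathbb{Q},\mathbb{P}$ to $\mathcal{F}_t$. $\tau_\lambda(dt)=\mathbf{1}_{\{t\ge0\}}\lambda^{-1}e^{-t/\lambda}\,dt$. *)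

(* Defs.v *)
From HB Require Import structures.
From mathcomp Require Import all_boot all_order all_algebra.
From mathcomp Require Import all_classical all_reals all_analysis.
From mathcomp Require Import lra.

Set Implicit Arguments.
Unset Strict Implicit.
Unset Printing Implicit Defensive.

Import Order.TTheory GRing.Theory Num.Theory.
Import numFieldNormedType.Exports.

Local Open Scope classical_set_scope.
Local Open Scope ring_scope.

(* A Polish space is given by a complete metric and the hypothesis
   [separable].  Measurable types of the library are pointed, hence so is the
   state space. *)
#[short(type="completeMetricType")]
HB.structure Definition CompleteMetric (R : numDomainType) :=
  {T of Complete T & Metric R T & Pointed T}.

Definition separable (T : topologicalType) : Prop :=
  exists2 D : set T, countable D & dense D.

Definition borel (T : ptopologicalType) : Type :=
  g_sigma_algebraType (@open T).

HB.instance Definition _ (T : ptopologicalType) :=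
  Measurable.on (borel T).

Definition Cb (R : realType) (T : topologicalType) : set (T -> R) :=
  [set f | continuous f /\ bounded_fun (f : T -> R^o)].
Arguments Cb : clear implicits.

(* Paths are functions on all of [R], extended to the negative times by their
   value at time 0, so that the type is in bijection with the set of cadlag
   functions from [0, +oo[ to E. *)
Record skorokhod (R : realType) (E : metricType R) := Skorokhod {
  traj :> R -> E ;
  path_right : forall t : R, 0 <= t -> traj s @[s --> t^'+] --> traj t ;
  path_left : forall t : R, 0 < t -> exists l : E, traj s @[s --> t^'-] --> l ;
  path_neg : forall t : R, t < 0 -> traj t = traj 0 }.
Arguments path_right {R E} _ {t}.
Arguments path_left {R E} _ {t}.
Arguments path_neg {R E} _ {t}.

HB.instance Definition _ (R : realType) (E : metricType R) :=
  gen_eqMixin (skorokhod E).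
HB.instance Definition _ (R : realType) (E : metricType R) :=
  gen_choiceMixin (skorokhod E).

Section constant_path.
Context (R : realType) (E : metricType R) (x : E).

Let cst_right (t : R) : 0 <= t -> (cst x : R -> E) s @[s --> t^'+] --> x.
Proof. by move=> _; exact: cvg_cst. Qed.

Let cst_left (t : R) : 0 < t -> exists l : E, (cst x : R -> E) s @[s --> t^'-] --> l.
Proof. by move=> _; exists x; exact: cvg_cst. Qed.

Definition constant_path : skorokhod E :=
  @Skorokhod R E (cst x) cst_right cst_left (fun _ _ => erefl).

End constant_path.

Section skorokhod_topology.
Context {R : realType}.

Definition time_change (l : R -> R) : Prop :=
  {in `[0, +oo[ &, {homo l : s t / s < t}} /\ l @` `[0, +oo[%classic = `[0, +oo[%classic.

Context {E : metricType R}.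

(* The sets [J1_nbhs X T e] form a basis of neighbourhoods of X for the
   Skorokhod (J1) topology: Y_n converges to X if and only if, for each T,
   there are time changes l_n such that sup_(t <= T) |l_n t - t| and
   sup_(t <= T) d (X (l_n t)) (Y_n t) tend to 0 (Ethier & Kurtz, Markov
   Processes, Proposition 3.5.3 (c)). *)
Definition J1_nbhs (X : skorokhod E) (T e : R) : set (skorokhod E) :=
  [set Y | exists2 l, time_change l & forall t : R, 0 <= t <= T ->
    `|l t - t| < e /\ mdist (X (l t)) (Y t) < e].

Definition J1_open (U : set (skorokhod E)) : Prop :=
  forall X, U X -> exists T e : R, 0 < e /\ J1_nbhs X T e `<=` U.

Let J1_openT : J1_open setT.
Proof. by move=> X _; exists 0, 1; split. Qed.

Let J1_openI : setI_closed J1_open.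
Proof.
move=> U V oU oV X [/oU[T1 [e1 [e10 U1]]] /oV[T2 [e2 [e20 V2]]]].
exists (Num.max T1 T2), (Num.min e1 e2); split; first by rewrite lt_min e10.
move=> Y [l tl lY]; split; [apply: U1|apply: V2]; exists l => // t /andP[t0 tT].
- by have := lY t; rewrite t0 le_max tT /= !lt_min => /(_ isT)[/andP[-> _] /andP[]].
- by have := lY t; rewrite t0 le_max tT orbT /= !lt_min
    => /(_ isT)[/andP[_ ->] /andP[]].
Qed.

Let J1_open_bigU (I : Type) (F : I -> set (skorokhod E)) :
  (forall i, J1_open (F i)) -> J1_open (\bigcup_i F i).
Proof.
move=> oF X [i _ /oF[T [e [e0 Fi]]]]; exists T, e; split => // Y /Fi FY.
by exists i.
Qed.

HB.instance Definition _ := isOpenTopological.Build (skorokhod E)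
  J1_openT J1_openI J1_open_bigU.

Lemma skorokhod_openE : @open (skorokhod E) = J1_open.
Proof. by []. Qed.

End skorokhod_topology.

HB.instance Definition _ (R : realType) (E : completeMetricType R) :=
  isPointed.Build (skorokhod E) (constant_path (point : E)).

HB.instance Definition _ (R : realType) (E : completeMetricType R) :=
  Measurable.copy (skorokhod E) (borel (skorokhod E)).

(* [weak_prob E] is the set of Borel probability measures on the Skorokhod
   space with the weak topology, i.e., the initial topology for the maps
   P |-> \int F dP with F bounded and continuous. *)
Section weak_topology.
Context {R : realType} (E : completeMetricType R).

Definition integral_Cb (P : probability (skorokhod E) R) :
    prod_topology (fun _ : set_type (Cb R (skorokhod E)) => R) :=
  fun F => \int[P]_X (set_val F X).

Definition weak_prob : Type := initial_topology integral_Cb.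

HB.instance Definition _ := Topological.on weak_prob.

End weak_topology.

Section filtration.
Context {R : realType} {E : completeMetricType R}.

Definition past (t : R) : set (set (skorokhod E)) :=
  \bigcup_(s in `[0, t])
    preimage_set_system setT (fun X : skorokhod E => X s) (@measurable _ (borel E)).

(* The Skorokhod space with the sigma-algebra generated by X(s), s <= t. *)
Definition filtration (t : R) : Type := g_sigma_algebraType (past t).

HB.instance Definition _ t := Measurable.on (filtration t).

Let in_shrink (U : set E) (e : R) : set E := [set z | ball z e `<=` U].

Let visit (U : set E) (t : R) : set (skorokhod E) :=
  [set X | exists2 e : R, 0 < e &
    forall u : R, 0 <= u -> `|u - t| < e -> in_shrink U e (X u)].

Let open_visit U (t : R) : 0 <= t -> open (visit U t).
Proof.
move=> t0; rewrite skorokhod_openE => X [e e0 Xe].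
exists (t + e), (e / 2); split; first by rewrite divr_gt0.
move=> Y [l [lmono limg] lY]; exists (e / 2); first by rewrite divr_gt0.
move=> u u0 ut z; rewrite ballEmdist /= => Yz.
have /lY[lu dY] : 0 <= u <= t + e.
  by rewrite u0 /=; move: ut; rewrite ltr_norml => /andP[_]; lra.
have l0 : 0 <= l u.
  have : (l @` `[0, +oo[) (l u) by exists u => //=; rewrite in_itv /= u0.
  by rewrite limg /= in_itv /= andbT.
apply: (Xe (l u) l0); last first.
  rewrite ballEmdist /= (le_lt_trans (metric_triangle _ (Y u) _))//.
  by rewrite (splitr e) ltrD.
rewrite (_ : l u - t = (l u - u) + (u - t)); last by rewrite addrA subrK.
by rewrite (le_lt_trans (ler_normD _ _))// (splitr e) ltrD.
Qed.

Let open_preimageE (U : set E) (s : R) : 0 <= s -> open U ->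
  (fun X : skorokhod E => X s) @^-1` U =
  \bigcup_m \bigcup_N \bigcap_(n in [set n | (N <= n)%N])
    visit (in_shrink U m.+1%:R^-1) (s + n.+1%:R^-1).
Proof.
move=> s0 oU; apply/seteqP; split=> [X /= UX|X [m _ [N _ Xmn]]].
  have : nbhs (X s) U by exact: open_nbhs_nbhs.
  move/nbhs_ballP => [r /= r0 rU].
  have r40 : 0 < r / 4 by rewrite divr_gt0.
  have := path_right X s0 => /(_ _ (nbhsx_ballx (X s) _ r40)).
  rewrite /nbhs /= /at_right/= => -[d /= d0 dX].
  have [m mr] : exists m : nat, m.+1%:R^-1 < r / 4.
    have /ltr_add_invr[k] : 0 < r / 4 by [].
    by rewrite add0r => ?; exists k.
  have [N Nd] : exists N : nat, N.+1%:R^-1 < d / 2.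
    have /ltr_add_invr[k] : 0 < d / 2 by rewrite divr_gt0.
    by rewrite add0r => ?; exists k.
  exists m => //; exists N => // n /= Nn.
  have n0 : 0 < n.+1%:R^-1 :> R by rewrite invr_gt0.
  have nd : n.+1%:R^-1 < d / 2.
    by rewrite (le_lt_trans _ Nd)// lef_pV2 ?posrE// ler_nat.
  exists (Num.min n.+1%:R^-1 (r / 4)); first by rewrite lt_min n0.
  move=> u u0; rewrite lt_min => /andP[un ur] z; rewrite ballEmdist /= lt_min.
  move=> /andP[_ Xz] w; rewrite ballEmdist /= => zw.
  have us : s < u.
    move: un; rewrite ltr_norml => /andP[+ _].
    by rewrite ltrBrDl addrK.
  have : ball (X s) (r / 4) (X u).
    apply: dX => //=; rewrite distrC gtr0_norm ?subr_gt0//.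
    move: un; rewrite ltr_norml => /andP[_].
    rewrite ltrBlDl => un; rewrite ltrBlDl (lt_trans un)// -addrA ltrD2l.
    by rewrite (splitr d) ltrD.
  rewrite ballEmdist /= => sX.
  apply: rU; rewrite ballEmdist /=.
  rewrite (le_lt_trans (metric_triangle _ (X u) _))//.
  have := metric_triangle (X u) z w; move: sX Xz (lt_trans zw mr).
  set a := mdist _ _; set b := mdist _ _; set c := mdist _ _; set k := mdist _ _.
  move=> ? ? ? ?; rewrite (@lt_le_trans _ _ (r / 4 + (r / 4 + r / 4)))//.
    by rewrite ltrD// (@le_lt_trans _ _ (b + c))// ltrD.
  by move: r0; lra.
have m0 : 0 < m.+1%:R^-1 :> R by rewrite invr_gt0.
have := path_right X s0 => /(_ _ (nbhsx_ballx (X s) _ m0)).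
rewrite /nbhs /= /at_right/= => -[d /= d0 dX].
have [k kd] : exists k : nat, k.+1%:R^-1 < d.
  have /ltr_add_invr[k] : 0 < d by [].
  by rewrite add0r => ?; exists k.
pose n := maxn N k.
have n0 : 0 < n.+1%:R^-1 :> R by rewrite invr_gt0.
have [|e e0 /(_ (s + n.+1%:R^-1))] := Xmn n; first by rewrite /= leq_maxl.
rewrite subrr normr0 addr_ge0 ?(ltW n0)// => /(_ isT e0) Xe.
have {}Xe : in_shrink U m.+1%:R^-1 (X (s + n.+1%:R^-1)).
  by apply: Xe; exact: ballxx.
apply: Xe; apply: ball_sym; apply: dX; last by rewrite ltrDl.
rewrite /= opprD addrA subrr sub0r normrN gtr0_norm//.
by rewrite (le_lt_trans _ kd)// lef_pV2 ?posrE// ler_nat ltnS leq_maxr.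
Qed.

Lemma measurable_evaluation (s : R) : 0 <= s ->
  measurable_fun [set: skorokhod E] (fun X : skorokhod E => X s : borel E).
Proof.
move=> s0; apply: (@measurability _ _ _ (borel E) _ _ (@open E)) => //.
move=> _ [U oU <-]; rewrite setTI open_preimageE//.
apply: bigcup_measurable => m _; apply: bigcup_measurable => N _.
apply: bigcap_measurable; first by exists N => /=.
move=> n _; apply: sub_sigma_algebra; apply: open_visit.
by rewrite addr_ge0.
Qed.

Definition forget (t : R) : skorokhod E -> filtration t := id.

Let measurable_forget t : measurable_fun [set: skorokhod E] (forget t).
Proof.
apply: (@measurability _ _ _ (filtration t) _ _ (past t)) => //.
move=> _ [_ [s /= + [B mB <-]] <-]; rewrite in_itv /= => /andP[s0 _].
by rewrite !setTI; rewrite -[X in measurable X]setTI; exact: measurable_evaluation.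
Qed.

HB.instance Definition _ t :=
  @isMeasurableFun.Build _ _ _ _ (forget t) (@measurable_forget t).

End filtration.
Arguments filtration {R} E t.

Section relative_entropy.
Local Open Scope charge_scope.
Local Open Scope ereal_scope.
Context d (T : measurableType d) (R : realType).

Definition relative_entropy (nu mu : probability T R) : \bar R :=
  if `[< nu `<< mu >] then
    \int[nu]_x lne (('d (charge_of_finite_measure nu) '/d mu) x)
  else +oo.

End relative_entropy.

Section martingales.
Context {R : realType} {E : completeMetricType R}.
Implicit Types P Q : probability (skorokhod E) R.

Definition martingale P (M : R -> skorokhod E -> R) : Prop :=
  [/\ forall t : R, 0 <= t -> measurable_fun [set: filtration E t] (M t),
      forall t : R, 0 <= t -> P.-integrable setT (EFin \o M t) &
      forall s t : R, 0 <= s <= t -> forall A : set (filtration E s), measurable A ->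
        \int[P]_(X in A) M t X = \int[P]_(X in A) M s X].

Definition time_integral (g : E -> R) (t : R) (X : skorokhod E) : R :=
  \int[lebesgue_measure]_(s in `[0, t]) g (X s).

Definition solves (A : set ((E -> R) * (E -> R)))
    P (nu : probability (borel E) R) : Prop :=
  (forall B : set (borel E), measurable B ->
     P ((fun X : skorokhod E => X 0) @^-1` B) = nu B) /\
  (forall f g, A (f, g) ->
     martingale P (fun t X => f (X t) - f (X 0) - time_integral g t X)).

(* Measures are functions on all sets: they are equal as measures when they
   agree on measurable sets. *)
Definition well_posed (A : set ((E -> R) * (E -> R))) : Prop :=
  forall nu : probability (borel E) R,
    exists P, solves A P nu /\ forall Q, solves A Q nu ->
      forall B, measurable B -> Q B = P B.

(* An operator is identified with its graph. *)
Definition linear_operator (A : set ((E -> R) * (E -> R))) : Prop :=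
  [/\ A `<=` Cb R E `*` Cb R E,
      A (cst 0, cst 0),
      forall (a : R) f1 g1 f2 g2, A (f1, g1) -> A (f2, g2) ->
        A ((fun x => a * f1 x + f2 x), (fun x => a * g1 x + g2 x)) &
      forall f g1 g2, A (f, g1) -> A (f, g2) -> g1 = g2].

(* S_t: [distribution Q (forget t)] is the restriction of Q to the
   sigma-algebra of [filtration E t]. *)
Definition entropy_upto (t : R) Q P : \bar R :=
  relative_entropy (distribution Q (forget t)) (distribution P (forget t)).

(* [exponential_prob lambda^-1] is the law lambda^-1 * exp (- t / lambda) dt
   on [0, +oo[. *)
Definition resolvent (P : E -> probability (skorokhod E) R)
    (lambda : R) (h : E -> R) (x : E) : \bar R :=
  ereal_sup [set (\int[exponential_prob lambda^-1]_(t in `[0%R, +oo[)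
    ((\int[Q]_X (h (X t))%:E) - entropy_upto t Q (P x)))%E
    | Q in [set: probability (skorokhod E) R]].

End martingales.

(* Main.v *)
Require Import Defs.
From HB Require Import structures.
From mathcomp Require Import all_boot all_order all_algebra.
From mathcomp Require Import all_classical all_reals all_analysis.
From mathcomp Require Import measurable_realfun lra.

Set Implicit Arguments.
Unset Strict Implicit.
Unset Printing Implicit Defensive.

Import Order.TTheory GRing.Theory Num.Theory.
Import numFieldNormedType.Exports.

Local Open Scope classical_set_scope.
Local Open Scope ring_scope.

(* Let phi_t = f(X(t)) - f(X(0)) - \int_0^t g(X(s)) ds, so that exp(phi_t) is a
   P_x-martingale of mean 1.  The Donsker-Varadhan inequality gives
   S_t(Q | P_x) >= E_Q[phi_t]; with G(s) = E_Q[g(X(s))] and h = f - lambda g,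
   this says that E_Q[h(X(t))] - S_t(Q | P_x) is at most
   f(x) - lambda G(t) + \int_0^t G(s) ds, whose integral against tau_lambda is
   f(x) since tau_lambda([s, +oo[) = exp(- s / lambda).
   Conversely, for the measure Q_T = exp(phi_T) P_x the entropy up to time t is
   E_(Q_T)[phi_(min t T)], so the inequality is an equality up to time T, and
   the contribution of the times after T vanishes as T tends to infinity. *)

(** * Monotonicity of the integral, and measures given by a density *)

Section integral_complements.
Local Open Scope ereal_scope.
Context d (T : measurableType d) (R : realType).

Import HBNNSimple.

(** Positive and negative parts are compared separately: each integral is a supremum over the simple
    functions below the integrand, which is monotone for arbitrary functions. Integrals of
    [t |-> entropy_upto t Q P] can thus be bounded without studying measurability in [t]. *)
Lemma le_integral_nonmeasurable (mu : {measure set T -> \bar R}) (D : set T)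
    (f g : T -> \bar R) :
  (forall x, D x -> f x <= g x) ->
  \int[mu]_(x in D) f x <= \int[mu]_(x in D) g x.
Proof.
have mono (u v : T -> \bar R) : (forall x, 0 <= u x) ->
    (forall x, D x -> u x <= v x) -> (forall x, 0 <= v x) ->
    \int[mu]_(x in D) u x <= \int[mu]_(x in D) v x.
  move=> u0 uv v0; rewrite !ge0_integralE//.
  apply: ereal_sup_le => _ [h /= hu <-]; exists h => // x.
  by apply: le_trans (hu x) _; apply: lee_restrict uv x.
move=> fg; rewrite integralE [leRHS]integralE leeB//; apply: mono => // x Dx.
  by apply: (@funepos_le _ _ D); rewrite ?inE// => y /[!inE]; exact: fg.
by apply: (@funeneg_le _ _ D); rewrite ?inE// => y /[!inE]; exact: fg.
Qed.

(** The measure is the set function of integrals itself, so the equality holds on every set,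
    measurable or not; [exponential_probability] relies on this to identify set functions. *)
Lemma exists_density (mu : {measure set T -> \bar R}) (p : T -> R) :
  measurable_fun setT p -> (forall x, (0 <= p x)%R) ->
  \int[mu]_x (p x)%:E = 1 ->
  exists Q : probability T R,
    forall B, Q B = \int[mu]_(x in B) (p x)%:E.
Proof.
move=> mp p0 p1; pose m B := \int[mu]_(x in B) (p x)%:E.
have m0 : m set0 = 0 by rewrite /m integral_set0.
have mge0 B : 0 <= m B by apply: integral_ge0 => x _; rewrite lee_fin.
have madd : semi_sigma_additive m.
  apply: semi_sigma_additive_nng_induced; first exact/measurable_EFinP.
  by move=> x; rewrite lee_fin.
pose mM := isMeasure.Build _ _ _ m m0 mge0 madd.
pose m_ : {measure set T -> \bar R} := HB.pack m mM.
pose mP := @Measure_isProbability.Build _ _ _ m_ p1.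
pose Q : probability T R := HB.pack m mM mP.
by exists Q.
Qed.

(** Having the same integrals over measurable sets, [p] and the Radon-Nikodym derivative of [nu]
    agree [mu]-almost everywhere, so the change of variables for the derivative applies to [p]. *)
Lemma integral_density (nu : {finite_measure set T -> \bar R})
    (mu : {sigma_finite_measure set T -> \bar R}) (p f : T -> \bar R) :
  measurable_fun setT p -> (forall x, 0 <= p x) ->
  (forall B, measurable B -> nu B = \int[mu]_(x in B) p x) ->
  measurable_fun setT f -> (forall x, 0 <= f x) ->
  \int[nu]_x f x = \int[mu]_x (f x * p x).
Proof.
move=> mp p0 nuE mf f0.
have numu : nu `<< mu.
  apply/null_content_dominatesP => B mB B0; rewrite nuE//.
  by rewrite null_set_integral//; exact: measurable_funTS.
have nup := Radon_Nikodym_SigmaFinite.f_integrable numu.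
rewrite -(Radon_Nikodym_SigmaFinite.change_of_variables numu)//.
apply: ae_eq_integral => //.
- by apply: emeasurable_funM => //; exact: measurable_int nup.
- exact: emeasurable_funM.
- apply: ae_eqe_mul2l; apply: integral_ae_eq => // B _ mB.
  by rewrite -nuE// -Radon_Nikodym_SigmaFinite.f_integral.
Qed.

Lemma integrable_bounded (mu : {measure set T -> \bar R}) (D : set T)
    (f : T -> R) (K : R) : measurable D -> mu D < +oo -> measurable_fun D f ->
  (forall x, D x -> (`|f x| <= K)%R) -> mu.-integrable D (EFin \o f).
Proof.
move=> mD Doo mf fK; apply: measurable_bounded_integrable => //.
exists K; split; first exact: num_real.
by move=> M KM x Dx; apply: (le_trans (fK x Dx)); exact: ltW.
Qed.

Lemma integrable_probability_bounded (Q : probability T R) (D : set T)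
    (f : T -> R) (K : R) : measurable D -> measurable_fun setT f ->
  (forall x, (`|f x| <= K)%R) -> Q.-integrable D (EFin \o f).
Proof.
move=> mD mf fK; apply: (integrableS measurableT) => //.
apply: (integrable_bounded (K := K)) => //.
by rewrite (@le_lt_trans _ _ 1)// ?ltry//; exact: probability_le1.
Qed.

End integral_complements.

(** * Relative entropy: the Donsker-Varadhan bound and the case of an exponential density *)

Section relative_entropy.
Local Open Scope ereal_scope.
Context d (T : measurableType d) (R : realType).
Implicit Types nu mu : probability T R.

Lemma measurable_lne : measurable_fun [set: \bar R] (@lne R).
Proof.
rewrite [X in measurable_fun _ X](_ : _ = fun x => if 0 < x then
    (if x == +oo then +oo else (ln (fine x))%:E) else -oo); last first.
  apply/funext => -[r| |]/=; rewrite ?ltry ?ltNyr ?lte_fin//.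
  by case: (ltP 0%R r).
apply: measurable_fun_ifT => //.
  exact: measurable_fun_lte.
apply: measurable_fun_ifT => //.
  exact: measurable_fun_eqe.
by apply/measurable_EFinP; apply: measurableT_comp.
Qed.

Local Open Scope charge_scope.

(** A pointwise lower bound on the log-density is integrated against [nu]: the subtracted term e^phi
    / f has integral at most that of e^phi against [mu], hence at most 1, and the summand 1
    compensates it. *)
Lemma relative_entropy_ge nu mu (phi : T -> R) : nu `<< mu ->
  nu.-integrable setT (EFin \o phi) ->
  \int[mu]_x (expR (phi x))%:E <= 1 ->
  \int[nu]_x (phi x)%:E <= relative_entropy nu mu.
Proof.
move=> numu iphi phi1.
have mphi : measurable_fun setT phi.
  exact/measurable_EFinP/(measurable_int nu).
rewrite /relative_entropy asboolT//.
(* [ln y >= phi + 1 - e^phi / y] for [y = f x]; this version [f] of the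
   density is nonnegative everywhere. *)
pose f := Radon_Nikodym_SigmaFinite.f nu mu.
have f0 x : (0 <= fine (f x))%R.
  by rewrite fine_ge0//; exact: Radon_Nikodym_SigmaFinite.f_ge0.
have fE x : f x = (fine (f x))%:E.
  by rewrite fineK//; exact: Radon_Nikodym_SigmaFinite.f_fin_num.
have mf : measurable_fun setT (fine \o f).
  apply: measurableT_comp => //.
  exact: measurable_int (Radon_Nikodym_SigmaFinite.f_integrable numu).
pose u x := (phi x - ln (fine (f x)))%R.
have mu_ : measurable_fun setT u.
  by apply: measurable_funB => //; exact: measurableT_comp.
(* [w] is e^phi / f, set to 0 where [f] vanishes, so that [f * w] is at most e^phi everywhere. *)
pose w x := if (0 < fine (f x))%R then expR (u x) else 0%R.
have w0 x : (0 <= w x)%R by rewrite /w; case: ifP; rewrite ?expR_ge0.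
have mw : measurable_fun setT w.
  apply: measurable_fun_ifT => //; first exact: measurable_fun_ltr.
  exact: measurableT_comp.
have w1 : \int[nu]_x (w x)%:E <= 1.
  rewrite -(Radon_Nikodym_SigmaFinite.change_of_variables numu)//;
    last exact/measurable_EFinP.
  apply: le_trans phi1; apply: le_integral_nonmeasurable => x _.
  rewrite -/f fE -EFinM lee_fin /w.
  case: ifPn => [fx0|_]; last by rewrite mul0r expR_ge0.
  by rewrite expRB lnK ?posrE// divfK// gt_eqF.
have iw : nu.-integrable setT (EFin \o w).
  apply/integrableP; split; first exact/measurable_EFinP.
  under eq_integral do rewrite /= ger0_norm//.
  by rewrite (le_lt_trans w1)// ltry.
pose psi x := (phi x + 1 - w x)%R.
have mpsi : measurable_fun setT psi.
  by apply: measurable_funB => //; exact: measurable_funD.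
(* Where [f] vanishes, which is a [nu]-null set, the logarithm is replaced by [psi], so that
   [psi <= L] holds everywhere. *)
pose L x := if (0 < fine (f x))%R then ln (fine (f x)) else psi x.
have psiL x : (psi x <= L x)%R.
  rewrite /L; case: ifPn => // fx0.
  by have := expR_ge1Dx (u x); rewrite /psi /w fx0 {1}/u; lra.
rewrite [leRHS](@ae_eq_integral _ _ _ _ _ (EFin \o L))//.
- apply: (@le_trans _ _ (\int[nu]_x (psi x)%:E)); last first.
    by apply: le_integral_nonmeasurable => x _; rewrite lee_fin.
  rewrite /psi; under [leRHS]eq_integral do rewrite EFinB EFinD.
  rewrite integralB//; last first.
    by apply: integrableD => //; exact: finite_measure_integrable_cst.
  rewrite integralD//; last exact: finite_measure_integrable_cst.
  rewrite integral_cst// [X in 1 * X](_ : _ = 1) ?mule1;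
    last exact: probability_setT.
  rewrite -addeA leeDl//.
  by rewrite sube_ge0// integrable_fin_num.
- apply: measurableT_comp; first exact: measurable_lne.
  exact: measurable_int (Radon_Nikodym_integrable _).
- apply/measurable_EFinP; apply: measurable_fun_ifT => //.
  + exact: measurable_fun_ltr.
  + exact: measurableT_comp.
(* The derivative in the definition of the entropy agrees with [f] [mu]-almost everywhere, hence
   [nu]-almost everywhere by absolute continuity. *)
have Df := null_dominates_ae_eq measurableT numu
  (ae_eq_Radon_Nikodym_SigmaFinite numu measurableT).
pose N := [set x | fine (f x) = 0%R].
have mN : measurable N.
  by rewrite -[N]setTI; exact: (mf measurableT [set 0%R]).
have N0 : nu N = 0.
  rewrite (Radon_Nikodym_SigmaFinite.f_integral numu)//.
  by rewrite integral0_eq// => x Nx; rewrite -/f fE Nx.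
have N0' : {ae nu, forall x, ~ N x} by exists N; split => // x /contrapT.
apply: filterS2 Df N0' => x Df Nx _ /=.
rewrite -(Df I) -/f fE lne_EFin; last first.
  by rewrite lt_neqAle f0 andbT eq_sym; exact/eqP.
by rewrite /L ifT// lt_neqAle f0 andbT eq_sym; exact/eqP.
Qed.

(** The derivative is e^phi [mu]-almost everywhere, hence [nu]-almost everywhere, and its logarithm
    is [phi]. *)
Lemma relative_entropy_density nu mu (phi : T -> R) :
  measurable_fun setT phi ->
  (forall B, measurable B -> nu B = \int[mu]_(x in B) (expR (phi x))%:E) ->
  relative_entropy nu mu = \int[nu]_x (phi x)%:E.
Proof.
move=> mphi nuE.
have mexp : measurable_fun setT (fun x => (expR (phi x))%:E).
  by apply/measurable_EFinP; exact: measurableT_comp.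
have numu : nu `<< mu.
  apply/null_content_dominatesP => B mB B0; rewrite nuE//.
  by rewrite null_set_integral//; exact: measurable_funTS.
rewrite /relative_entropy asboolT//; apply: ae_eq_integral => //.
- apply: measurableT_comp; first exact: measurable_lne.
  exact: measurable_int (Radon_Nikodym_integrable _).
- exact/measurable_EFinP.
have : ae_eq mu setT ('d (charge_of_finite_measure nu) '/d mu)
    (fun x => (expR (phi x))%:E).
  apply: integral_ae_eq => //; first exact: Radon_Nikodym_integrable.
  by move=> B _ mB; rewrite -nuE// -Radon_Nikodym_integral.
move/(null_dominates_ae_eq measurableT numu); apply: filterS.
move=> x /(_ I) /= -> _.
by rewrite lne_EFin ?expR_gt0// expRK.
Qed.

End relative_entropy.

(** * Averages against the exponential law *)

Section exponential_law.
Local Open Scope ereal_scope.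
Context (R : realType).

(** The equality is one of set functions, so the law in the definition of [resolvent] can be
    rewritten into the bundled probability [tau]. *)
Lemma exponential_probability (rate : R) : (0 < rate)%R ->
  exists tau : probability (measurableTypeR R) R,
    tau = exponential_prob rate :> (set R -> \bar R).
Proof.
move=> r0; have [tau tauE] := @exists_density _ (measurableTypeR R) R
  (@lebesgue_measure R) _ (measurable_exponential_pdf rate)
  (exponential_pdf_ge0 (ltW r0)) (integral_exponential_pdf r0).
by exists tau; apply/funext => B; rewrite tauE.
Qed.

Variables (lambda : R) (tau : probability (measurableTypeR R) R).
Hypothesis lambda0 : (0 < lambda)%R.
Hypothesis tauE : tau = exponential_prob lambda^-1 :> (set R -> \bar R).

Local Notation leb := (@lebesgue_measure R).
Local Notation D := (`[0%R, +oo[%classic : set R).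
Local Notation J G t := (\int[leb]_(s in `[0%R, t]) G s)%R.

Let rate0 : (0 < lambda^-1)%R. Proof. by rewrite invr_gt0. Qed.

Lemma exponential_prob_tail_oy (s : R) : (0 <= s)%R ->
  tau `]s, +oo[%classic = (expR (- lambda^-1 * s))%:E.
Proof.
move=> s0.
have -> : `]s, +oo[%classic = ~` `]-oo, s]%classic :> set R.
  by rewrite setCitvl.
rewrite probability_setC; last exact: measurable_itv.
have -> : tau `]-oo, s]%classic = exponential_prob lambda^-1 `[0%R, s]%classic.
  rewrite tauE /exponential_prob [LHS]integral_mkcond [RHS]integral_mkcond.
  apply: eq_integral => x _; rewrite !patchE.
  have [x0|x0] := leP 0%R x.
    congr (if _ then _ else _).
    by apply/idP/idP; rewrite !inE/= !in_itv/= x0.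
  rewrite lt0_exponential_pdf// !if_same//.
move: s0; rewrite le_eqVlt => /predU1P[<-|s0].
  by rewrite set_itv1 mulr0 expR0 -tauE /= /exponential_prob tauE
    /exponential_prob integral_set1 sube0.
by rewrite exponential_prob_itv0c// oppeB// addeA subee// add0e.
Qed.

Lemma exponential_prob_tail_cy (s : R) : (0 <= s)%R ->
  tau `[s, +oo[%classic = (expR (- lambda^-1 * s))%:E.
Proof.
move=> s0; rewrite -exponential_prob_tail_oy// tauE /exponential_prob.
rewrite [RHS]integral_itv_obnd_cbnd//.
by apply/measurable_funTS/measurable_EFinP; exact: measurable_exponential_pdf.
Qed.

Lemma integral_exponential_prob_ge0 (f : R -> \bar R) :
  measurable_fun D f -> (forall x, D x -> 0 <= f x) ->
  \int[tau]_(t in D) f t =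
  \int[leb]_(t in D) (f t * (lambda^-1 * expR (- lambda^-1 * t))%:E).
Proof.
move=> mf f0; rewrite integral_mkcond.
rewrite (@integral_density _ _ _ tau leb (EFin \o exponential_pdf lambda^-1))//.
- rewrite [RHS]integral_mkcond; apply: eq_integral => x _; rewrite !patchE.
  case: ifPn => [|_]; last by rewrite mul0e.
  by rewrite inE/= in_itv/= andbT => x0; rewrite exponential_pdfE.
- by apply/measurable_EFinP; exact: measurable_exponential_pdf.
- by move=> x; rewrite lee_fin exponential_pdf_ge0// ltW.
- by move=> B _; exact: (congr1 (fun m : set R -> \bar R => m B) tauE).
- by apply/(measurable_restrictT _ _).1.
- exact: erestrict_ge0.
Qed.

Lemma measurable_triangle :
  measurable [set z : measurableTypeR R * measurableTypeR R |
    (0 <= z.2)%R && (z.2 <= z.1)%R].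
Proof.
rewrite [X in measurable X](_ : _ =
  (fun z => (0 <= z.2)%R && (z.2 <= z.1)%R) @^-1` [set true]) ?setTI//.
rewrite -[X in measurable X]setTI.
apply: (measurable_and _ _ measurableT) => //.
- exact: measurable_fun_ler.
- exact: measurable_fun_ler.
Qed.

(* Tonelli on the triangle [0 <= s <= t], whose sections at fixed [s] have
   mass [expR (- s / lambda)], i.e., lambda times the density at [s]. *)
Lemma integral_exponential_prob_primitive (G : R -> R) :
  measurable_fun [set: R] G -> (forall s, (0 <= G s)%R) ->
  measurable_fun [set: R] (fun t => \int[leb]_(s in `[0%R, t]) (G s)%:E) /\
  \int[tau]_(t in D) \int[leb]_(s in `[0%R, t]) (G s)%:E =
  \int[tau]_(t in D) (lambda * G t)%:E.
Proof.
move=> mG G0.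
pose A := [set z : measurableTypeR R * measurableTypeR R |
  (0 <= z.2)%R && (z.2 <= z.1)%R].
have mA : measurable A by exact: measurable_triangle.
pose F : measurableTypeR R * measurableTypeR R -> \bar R :=
  (fun z => (G z.2)%:E) \_ A.
have F0 z : 0 <= F z by apply: erestrict_ge0 => *; rewrite lee_fin.
have mF : measurable_fun setT F.
  apply/(measurable_restrictT _ _).1 => //; apply: measurable_funTS.
  by apply/measurable_EFinP; exact: measurableT_comp.
have FE t : \int[leb]_(s in `[0%R, t]) (G s)%:E = \int[leb]_s F (t, s).
  rewrite integral_mkcond; apply: eq_integral => s _.
  by rewrite /F !patchE (_ : ((t, s) \in A) = (s \in `[0%R, t]%classic)).
split.
  under eq_fun do rewrite FE.
  exact: (measurable_fun_fubini_tonelli_F F).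
rewrite integral_mkcond (eq_integral (fun t => \int[leb]_s F (t, s)));
  last first.
  move=> t _; rewrite patchE FE; case: ifPn => //.
  rewrite notin_setE/= in_itv/= andbT => /negP; rewrite -ltNge => t0.
  rewrite integral0_eq// => s _; rewrite /F patchE ifF//.
  apply/negbTE; rewrite notin_setE/= /A/= => /andP[s0 st].
  by move: t0; rewrite ltNge (le_trans s0).
rewrite (fubini_tonelli F)//.
rewrite integral_exponential_prob_ge0; last 2 first.
- by apply: measurable_funTS; apply/measurable_EFinP; exact: measurable_funM.
- by move=> x _; rewrite lee_fin mulr_ge0// ltW.
rewrite [RHS]integral_mkcond; apply: eq_integral => s _.
rewrite patchE; case: ifPn => [|]; rewrite ?inE ?notin_setE/= in_itv/= andbT.
  move=> s0; transitivity
    (\int[tau]_t ((G s)%:E * (\1_(`[s, +oo[%classic : set R) t)%:E)).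
    apply: eq_integral => t _; rewrite /F patchE indicE -EFinM.
    rewrite (_ : (t, s) \in A = (t \in `[s, +oo[%classic)).
      by case: ifP; rewrite ?mulr1 ?mulr0.
    by apply/idP/idP; rewrite !inE/= /A/= in_itv/= andbT s0.
  rewrite ge0_integralZl//= ?lee_fin//; last first.
    by apply/measurable_EFinP; exact: measurable_indic.
  rewrite integral_indic//= setIT.
  rewrite exponential_prob_tail_cy// -!EFinM; congr EFin.
  rewrite mulrACA mulfV ?mul1r ?gt_eqF//.
move=> /negP s0; rewrite integral0_eq// => t _; rewrite /F patchE ifF//.
by apply/negbTE; rewrite notin_setE/= /A/= (negbTE s0).
Qed.

Lemma integrable_itv_bounded (f : R -> R) (K t : R) :
  measurable_fun [set: R] f -> (forall s, (`|f s| <= K)%R) ->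
  leb.-integrable `[0%R, t] (EFin \o f).
Proof.
move=> mf fK; apply: (@integrable_bounded _ _ _ _ _ _ K) => //.
- by rewrite /= lebesgue_measure_itv /=; case: ifP; rewrite -?EFinB ltry.
- exact: measurable_funTS.
Qed.

(** By Tonelli both terms have the same integral, which is finite because [G] is bounded; the two
    can therefore be subtracted. *)
Let primitive_ge0 (G : R -> R) (K : R) : measurable_fun [set: R] G ->
  (forall s, (0 <= G s <= K)%R) ->
  tau.-integrable D (fun t => (J G t - lambda * G t)%:E) /\
  \int[tau]_(t in D) (J G t - lambda * G t)%:E = 0.
Proof.
move=> mG GK.
have G0 s : (0 <= G s)%R by have /andP[] := GK s.
have GK' s : (`|G s| <= K)%R by rewrite ger0_norm//; have /andP[] := GK s.
have [mJ JE] := integral_exponential_prob_primitive mG G0.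
have JEFin t : (J G t)%:E = \int[leb]_(s in `[0%R, t]) (G s)%:E.
  by rewrite fineK// integrable_fin_num//; exact: integrable_itv_bounded GK'.
have ilG : tau.-integrable D (fun t => (lambda * G t)%:E).
  apply: (@integrable_probability_bounded _ _ _ _ _ _ (lambda * K)) => //.
    exact: measurable_funM.
  by move=> s; rewrite normrM gtr0_norm// ler_pM2l.
have iJ : tau.-integrable D (fun t => (J G t)%:E).
  apply/integrableP; split.
    by apply: measurable_funTS; under eq_fun do rewrite JEFin.
  under eq_integral => t _.
    rewrite JEFin gee0_abs; last by apply: integral_ge0 => s _; rewrite lee_fin.
    over.
  by rewrite JE ltey_eq integrable_fin_num.
split; first exact: (integrableB _ iJ ilG).
transitivity (\int[tau]_(t in D) ((J G t)%:E - (lambda * G t)%:E)) => //.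
rewrite integralB//; under eq_integral do rewrite JEFin.
by rewrite JE subee// integrable_fin_num.
Qed.

(** The nonnegative case is applied to [G + K] and to the constant [K], whose difference is [G]. The
    constant [c] is preserved because [tau] gives mass 1 to [D]. *)
Lemma integral_exponential_prob_resolvent (G : R -> R) (K c : R) :
  measurable_fun [set: R] G -> (forall s, (`|G s| <= K)%R) ->
  tau.-integrable D (fun t => (c - lambda * G t + J G t)%:E) /\
  \int[tau]_(t in D) (c - lambda * G t + J G t)%:E = c%:E.
Proof.
have alg (g k a b : R) : (c - lambda * g + a =
    c + (a + b - lambda * (g + k) - (b - lambda * k)))%R by lra.
move=> mG GK; have K0 : (0 <= K)%R := le_trans (normr_ge0 _) (GK 0%R).
have GKK s : (0 <= G s + K <= K + K)%R.
  by have := GK s; rewrite ler_norml; lra.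
have [i1 e1] := primitive_ge0
  (measurable_funD mG (measurable_cst K : measurable_fun _ (cst K))) GKK.
have [|i2 e2] := @primitive_ge0 (cst K) K (measurable_cst K).
  by move=> s /=; rewrite K0 lexx.
have iK t : leb.-integrable `[0%R, t] (EFin \o cst K).
  exact: (@integrable_itv_bounded _ `|K|%R).
pose U t := c%:E + ((J (fun s => G s + K) t - lambda * (G t + K))%:E -
  (J (cst K) t - lambda * cst K t)%:E).
have E t : (c - lambda * G t + J G t)%:E = U t.
  rewrite /U -EFinB -EFinD RintegralD//; last exact: integrable_itv_bounded GK.
  by congr EFin; exact: alg.
have ic : tau.-integrable D (cst c%:E).
  exact: (@integrable_probability_bounded _ _ _ _ _ (cst c) `|c|%R).
have i12 := @integrableB _ _ _ tau D (measurable_itv _) _ _ i1 i2.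
split.
  rewrite (_ : (fun _ => _) = U); last exact/funext.
  exact: (integrableD _ ic i12).
transitivity (\int[tau]_(t in D) U t).
  by apply: eq_integral => t _; exact: E.
rewrite (integralD _ ic i12)// (integralB _ i1 i2)//.
rewrite [X in _ + (X - _)]e1 [X in _ + (_ - X)]e2 sube0 adde0 integral_cst//.
by rewrite [X in _ * X]exponential_prob_tail_cy// mulr0 expR0 mule1.
Qed.

End exponential_law.

(** * Joint measurability in time and path, and Fubini for time integrals *)

Section path_integrals.
Context (R : realType) (E : completeMetricType R).
Local Notation leb := (@lebesgue_measure R).
Implicit Types (Q : probability (skorokhod E) R) (phi : E -> R).

Lemma continuous_measurable_borel phi : continuous phi ->
  measurable_fun [set: borel E] phi.
Proof.
move=> cphi; apply: (measurability _ (RGenOInfty.measurableE R)) => //.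
move=> _ [_ [x ->] <-]; rewrite setTI; apply: sub_sigma_algebra.
by apply: open_comp; [move=> ? _; exact: cphi|exact: interval_open].
Qed.

Lemma measurable_comp_path phi (u : R) : continuous phi ->
  measurable_fun [set: skorokhod E] (fun X : skorokhod E => phi (X u)).
Proof.
move=> /continuous_measurable_borel mphi; have [u0|u0] := leP 0 u.
  exact: (measurableT_comp mphi (measurable_evaluation u0)).
under eq_fun do rewrite path_neg//.
exact: (measurableT_comp mphi (measurable_evaluation (lexx 0))).
Qed.

(** Paths are constant at negative times, so the grid approximation below converges at every real
    time. *)
Lemma path_right_everywhere (X : skorokhod E) (t : R) :
  X s @[s --> t^'+] --> X t.
Proof.
have [t0|t0] := leP 0 t; first exact: path_right.
apply: (@cvg_trans _ (cst (X 0) s @[s --> t^'+])).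
  apply: near_eq_cvg; near=> s.
  have s0 : s < 0 by near: s; exact: nbhs_right_lt.
  by rewrite (path_neg X s0).
by rewrite path_neg//; exact: cvg_cst.
Unshelve. all: by end_near. Qed.

(* Sampling strictly to the right of [s] lets right-continuity suffice. *)
Let grid (n : nat) (s : R) : R :=
  (Num.floor (n.+1%:R * s) + 1)%:~R / n.+1%:R.

Let grid_cvg (s : R) : grid ^~ s @ \oo --> s^'+.
Proof.
move=> P; rewrite /nbhs /= /at_right /= => -[e /= e0 eP].
near=> n.
have n0 : 0 < n.+1%:R :> R by [].
have /andP[fl fu] := floor_itv (n.+1%:R * s).
apply: eP => /=; last by rewrite /grid ltr_pdivlMr// [s * _]mulrC.
have : grid n s <= s + n.+1%:R^-1.
  by rewrite /grid intrD mulrDl mul1r lerD2r ler_pdivrMr// [s * _]mulrC.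
have : s < grid n s by rewrite /grid ltr_pdivlMr// [s * _]mulrC.
have : n.+1%:R^-1 < e by near: n; exact: (near_infty_natSinv_lt (PosNum e0)).
move=> ne sg gs; rewrite distrC gtr0_norm ?subr_gt0//.
by rewrite ltrBlDl (le_lt_trans gs)// ltrD2l.
Unshelve. all: by end_near. Qed.

Let measurable_grid phi n : continuous phi ->
  measurable_fun [set: measurableTypeR R * skorokhod E]
    (fun z => phi (z.2 (grid n z.1))).
Proof.
move=> cphi _ B mB; rewrite setTI.
(* The floor takes countably many values; once it is fixed, the sampling time is constant and the
   event is the product of a time interval and a path event. *)
rewrite [X in measurable X](_ : _ = \bigcup_(k : int)
    ([set s | Num.floor (n.+1%:R * s) = k] `*`
     (fun X : skorokhod E => phi (X ((k + 1)%:~R / n.+1%:R))) @^-1` B));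
  last first.
  apply/seteqP; split=> [[s X] /= BX|[s X] [k _] [/= <-]//].
  by exists (Num.floor (n.+1%:R * s)).
apply: countable_bigcupT_measurable => // k; apply: measurableX.
  rewrite [X in measurable X](_ : _ = (fun s => n.+1%:R * s) @^-1`
      `[k%:~R, (k + 1)%:~R[%classic); last first.
    apply/seteqP; split=> s /=; rewrite in_itv/=.
      by move=> <-; exact: floor_itv.
    by move/floor_def.
  rewrite -[X in measurable X]setTI.
  by apply: (@measurable_funM _ _ _ _ (cst n.+1%:R) id) => //.
by rewrite -[X in measurable X]setTI; exact: measurable_comp_path.
Qed.

(** By right-continuity of the paths and continuity of [phi], this is the pointwise limit of the
    grid samples. Exchanging time integrals and expectations rests on it. *)
Lemma measurable_path_joint phi : continuous phi ->
  measurable_fun [set: measurableTypeR R * skorokhod E]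
    (fun z => phi (z.2 z.1)).
Proof.
move=> cphi.
apply: (measurable_fun_cvg (h := fun n
  (z : measurableTypeR R * skorokhod E) => phi (z.2 (grid n z.1)))).
  by move=> n; exact: measurable_grid.
move=> [s X] _ /=.
have Xcvg := cvg_comp _ _ (@grid_cvg s) (@path_right_everywhere X s).
exact: (cvg_comp _ _ Xcvg (cphi (X s))).
Qed.

Lemma measurable_path phi (X : skorokhod E) : continuous phi ->
  measurable_fun [set: R] (fun s => phi (X s)).
Proof.
by move=> /measurable_path_joint /measurable_fun_pair1; exact.
Qed.

Variables (Q : probability (skorokhod E) R) (phi : E -> R) (K : R).
Hypothesis cphi : continuous phi.
Hypothesis phiK : forall x, `|phi x| <= K.

Let QT : Q [set: skorokhod E] = 1%E. Proof. exact: probability_setT. Qed.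

Let K0 : 0 <= K. Proof. exact: le_trans (normr_ge0 _) (phiK point). Qed.

Lemma integrable_comp_path (u : R) :
  Q.-integrable setT (fun X : skorokhod E => (phi (X u))%:E).
Proof.
apply: (@integrable_probability_bounded _ _ _ _ _ _ (K)) => //.
exact: measurable_comp_path.
Qed.

Definition mean (s : R) : R := \int[Q]_X phi (X s).

Lemma EFin_mean s : (mean s)%:E = (\int[Q]_X (phi (X s))%:E)%E.
Proof.
by rewrite fineK// integrable_fin_num//; exact: integrable_comp_path.
Qed.

Lemma normr_mean_le s : `|mean s| <= K.
Proof.
apply: le_trans (le_normr_Rintegral _ (integrable_comp_path s)) _ => //.
apply: (@le_trans _ _ (\int[Q]_X (cst K X))).
  apply: le_Rintegral => //.
  - exact: integrable_abse (integrable_comp_path s).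
  - exact: finite_measure_integrable_cst.
rewrite Rintegral_cst// [X in fine X]QT mulr1//.
Qed.

Lemma measurable_mean : measurable_fun [set: R] mean.
Proof.
(* Tonelli is used for a nonnegative integrand; adding [K] provides one, and the constant is
   subtracted at the end. *)
have mphiK : measurable_fun [set: measurableTypeR R * skorokhod E]
    (fun z => (phi (z.2 z.1) + K)%:E).
  by apply/measurable_EFinP/measurable_funD => //; exact: measurable_path_joint.
have phiK0 (z : measurableTypeR R * skorokhod E) :
    (0 <= (phi (z.2 z.1) + K)%:E)%E.
  by rewrite lee_fin; have := phiK (z.2 z.1); rewrite ler_norml; lra.
have : measurable_fun [set: R] (fun s => \int[Q]_X (phi (X s) + K)%:E)%E.
  exact: measurable_fun_fubini_tonelli_F mphiK phiK0.
rewrite (_ : (fun _ => _) = fun s => (mean s + K)%:E); last first.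
  apply/funext => s; rewrite EFinD EFin_mean.
  under eq_integral do rewrite EFinD.
  rewrite integralD//; [|exact: integrable_comp_path|
    exact: finite_measure_integrable_cst].
  by rewrite integral_cst// [X in (_ * X)%E]QT mule1.
move/measurable_EFinP => mK.
rewrite (_ : mean = fun s => (mean s + K) - K).
  exact: measurable_funB.
by apply/funext => s; rewrite addrK.
Qed.

Lemma normr_time_integral_le (t : R) (X : skorokhod E) :
  0 <= t -> `|time_integral phi t X| <= K * t.
Proof.
move=> t0; have mp := measurable_path X cphi.
have ip : leb.-integrable `[0, t] (fun s => (phi (X s))%:E).
  exact: (@integrable_itv_bounded _ _ K).
apply: le_trans (le_normr_Rintegral _ ip) _ => //.
apply: (@le_trans _ _ (\int[leb]_(s in `[0, t]) (cst K s))).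
  apply: le_Rintegral => //.
  - exact: integrable_abse ip.
  - apply: (@integrable_itv_bounded _ _ `|K|) => //.
rewrite Rintegral_cst//= lebesgue_measure_itv/= lte_fin.
case: ltP => _; last by rewrite /= mulr0 mulr_ge0.
by rewrite /= subr0.
Qed.

Lemma integral_time_integral (t : R) :
  (\int[Q]_X (time_integral phi t X)%:E =
   (\int[leb]_(s in `[0%R, t]) mean s)%R%:E)%E.
Proof.
(* The indicator moves the integral over [[0, t]] to the whole product space; [I] is integrable
   there because [phi] is bounded and the interval has finite length. *)
pose I := (fun z : measurableTypeR R * skorokhod E =>
  (\1_(`[0, t]%classic : set R) z.1 * phi (z.2 z.1))%:E).
have mI : measurable_fun setT I.
  apply/measurable_EFinP/measurable_funM; last exact: measurable_path_joint.
  exact: measurableT_comp (measurable_indic _) measurable_fst.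
have l0t : (leb `[0%R, t]%classic < +oo)%E.
  by rewrite /= lebesgue_measure_itv/=; case: ifP; rewrite -?EFinB ltry.
have iI : (leb \x Q)%E.-integrable setT I.
  apply/integrable12ltyP => //.
  apply: (@le_lt_trans _ _ (\int[leb]_(s in `[0%R, t]) (cst K%:E s))%E).
    rewrite [leRHS]integral_mkcond; apply: le_integral_nonmeasurable => s _.
    rewrite patchE /I; case: ifPn => st.
      apply: (@le_trans _ _ (\int[Q]_X (cst K%:E X))%E).
        apply: le_integral_nonmeasurable => X _ /=.
        by rewrite indicE st mul1r lee_fin.
      by rewrite integral_cst// [X in (_ * X)%E]QT mule1.
    by rewrite integral0_eq// => X _; rewrite indicE (negbTE st) mul0r abse0.
  by rewrite integral_cst// lte_mul_pinfty// lee_fin.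
have -> : (\int[Q]_X (time_integral phi t X)%:E)%E =
    (\int[Q]_X \int[leb]_s I (s, X))%E.
  apply: eq_integral => X _; rewrite fineK.
    rewrite integral_mkcond; apply: eq_integral => s _.
    by rewrite patchE /I indicE; case: ifP; rewrite ?mul1r ?mul0r.
  apply: integrable_fin_num => //.
  by apply: (@integrable_itv_bounded _ _ K) => //; exact: measurable_path.
rewrite -(Fubini iI) fineK; last first.
  apply: integrable_fin_num => //.
  apply: (@integrable_itv_bounded _ _ K); first exact: measurable_mean.
  exact: normr_mean_le.
rewrite [RHS]integral_mkcond; apply: eq_integral => s _.
rewrite patchE /I; case: ifPn => st.
  by rewrite EFin_mean; apply: eq_integral => X _; rewrite indicE st mul1r.
by rewrite integral0_eq// => X _; rewrite indicE (negbTE st) mul0r.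
Qed.

End path_integrals.

(** * The exponential martingale as a change of measure *)

Section exponential_martingale.
Context (R : realType) (E : completeMetricType R).

Lemma measurable_filtration_le (s t : R) (B : set (skorokhod E)) : s <= t ->
  measurable (B : set (filtration E s)) ->
  measurable (B : set (filtration E t)).
Proof.
move=> st; apply: smallest_sub; first exact: smallest_sigma_algebra.
move=> C Cs; apply: sub_sigma_algebra; apply: bigcup_subset Cs => r /=.
by rewrite !in_itv/= => /andP[-> rs]; exact: le_trans st.
Qed.

Lemma measurable_fun_filtration_le (s t : R) (u : skorokhod E -> R) : s <= t ->
  measurable_fun [set: filtration E s] u ->
  measurable_fun [set: filtration E t] u.
Proof.
move=> st mu_ _ B mB; rewrite setTI; apply: (measurable_filtration_le st).
by rewrite -[X in measurable X]setTI; exact: mu_.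
Qed.

Lemma measurable_fun_filtration (t : R) (u : skorokhod E -> R) :
  measurable_fun [set: filtration E t] u -> measurable_fun [set: skorokhod E] u.
Proof.
move=> mu_.
exact: (measurableT_comp mu_ (measurable_funPT (forget t))).
Qed.

(** As [forget] is the identity, pushing forward along it only restricts the sigma-algebra. *)
Lemma integral_distribution_forget (Q : probability (skorokhod E) R) (t K : R)
    (u : skorokhod E -> R) :
  measurable_fun [set: filtration E t] u -> (forall X, `|u X| <= K) ->
  (\int[distribution Q (forget t)]_X (u X)%:E = \int[Q]_X (u X)%:E)%E.
Proof.
move=> mu_ uK; rewrite integral_pushforward//.
- exact/measurable_EFinP.
- apply: (@integrable_probability_bounded _ _ _ _ _ _ (K)) => //.
  + by rewrite preimage_setT.
  + exact: measurable_fun_filtration mu_.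
Qed.

Variables (P : probability (skorokhod E) R) (phi : R -> skorokhod E -> R).
Variable (K : R -> R).
Hypothesis mart : martingale P (fun t X => expR (phi t X)).
Hypothesis phi0 : forall X, phi 0 X = 0.
Hypothesis phiK : forall t X, 0 <= t -> `|phi t X| <= K t.

(** Adaptedness is given for the exponential and recovered for the exponent by taking the
    logarithm. *)
Lemma measurable_exponent (t : R) : 0 <= t ->
  measurable_fun [set: filtration E t] (phi t).
Proof.
move=> t0; have [/(_ t t0) mphi _ _] := mart.
rewrite (_ : phi t = fun X => ln (expR (phi t X))).
  exact: measurableT_comp.
by apply/funext => X; rewrite expRK.
Qed.

(** The definition of [martingale] compares real-valued integrals; integrability makes both sides
    finite, so the equality lifts to the extended reals. *)
Lemma integral_exponential_martingale (s t : R) (B : set (filtration E s)) :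
  0 <= s <= t -> measurable B ->
  (\int[P]_(X in B) (expR (phi t X))%:E =
   \int[P]_(X in B) (expR (phi s X))%:E)%E.
Proof.
move=> /andP[s0 st] mB; have t0 := le_trans s0 st.
have mB' : measurable (B : set (skorokhod E)).
  exact: (measurable_funPTI (forget s) mB).
have [_ iM /(_ s t _ B mB)] := mart; rewrite s0 st => /(_ isT) E0.
have iB r : 0 <= r -> P.-integrable B (EFin \o (fun X => expR (phi r X))).
  by move=> r0; apply: integrableS (iM r r0).
rewrite -[LHS]fineK; last exact: integrable_fin_num (iB t t0).
by rewrite [X in X%:E]E0 fineK// integrable_fin_num//; exact: iB.
Qed.

Lemma expectation_exponential_martingale (t : R) : 0 <= t ->
  (\int[P]_X (expR (phi t X))%:E = 1)%E.
Proof.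
move=> t0; rewrite (@integral_exponential_martingale 0)// ?lexx//.
under eq_integral do rewrite phi0 expR0.
by rewrite integral_cst// mul1e; exact: probability_setT.
Qed.

(** This is the Donsker-Varadhan bound on the sigma-algebra of time [t]; its normalisation condition
    holds because the martingale has mean 1. *)
Lemma entropy_upto_ge (Q : probability (skorokhod E) R) (t : R) : 0 <= t ->
  distribution Q (forget t) `<< distribution P (forget t) ->
  (\int[Q]_X (phi t X)%:E <= entropy_upto t Q P)%E.
Proof.
move=> t0 QP; have mphi := measurable_exponent t0.
rewrite -(@integral_distribution_forget _ _ (K t) _ mphi); last first.
  by move=> X; exact: phiK.
apply: relative_entropy_ge => //.
- apply: (@integrable_probability_bounded _ _ _ _ _ _ (K t)) => // X.
  exact: phiK.
- rewrite (@integral_distribution_forget _ _ (expR (K t))).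
  + by rewrite expectation_exponential_martingale.
  + exact: measurableT_comp.
  + move=> X; rewrite ger0_norm ?expR_ge0// ler_expR.
    by rewrite (le_trans (ler_norm _))// phiK.
Qed.

(* The measure with density [expR (phi T)] only matches the martingale up to
   time [T], but this spares extending the family of such measures to a
   measure on the whole path space. *)
Lemma exists_tilted_probability (T : R) : 0 <= T ->
  exists Q : probability (skorokhod E) R, Q `<< P /\ forall t : R, 0 <= t ->
    entropy_upto t Q P = (\int[Q]_X (phi (Num.min t T) X)%:E)%E.
Proof.
move=> T0; have mT := measurable_fun_filtration (measurable_exponent T0).
have [||Q QE] := @exists_density _ _ _ P (fun X => expR (phi T X)) _ _
  (expectation_exponential_martingale T0).
- exact: measurableT_comp.
- by move=> X; exact: expR_ge0.
have mexp : measurable_fun [set: skorokhod E] (fun X => (expR (phi T X))%:E).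
  by apply/measurable_EFinP; exact: measurableT_comp.
exists Q; split.
  apply/null_content_dominatesP => B mB B0.
  by rewrite [LHS]QE null_set_integral//; exact: measurable_funTS.
move=> t t0; set m := Num.min t T.
have m0 : 0 <= m by rewrite le_min t0.
have mphi : measurable_fun [set: filtration E t] (phi m).
  apply: (@measurable_fun_filtration_le m); first by rewrite ge_min lexx.
  exact: measurable_exponent.
rewrite /entropy_upto.
rewrite (@relative_entropy_density _ (filtration E t) _ _ _ (phi m))//.
  by apply: (@integral_distribution_forget _ _ (K m)) => // X; exact: phiK.
move=> B mB; rewrite ge0_integral_pushforward//; last first.
  by apply: measurable_funTS; apply/measurable_EFinP; exact: measurableT_comp.
rewrite [LHS]QE.
(* Up to time [T], the martingale property replaces the density at [T] by the one at [t] on events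
   of the past of [t]; after [T], [m] is [T] and the two densities coincide. *)
rewrite /m; have [tT|Tt] := leP t T; last by [].
by apply: integral_exponential_martingale; rewrite ?t0.
Qed.

End exponential_martingale.

(** * Upper and lower bounds for the functional maximised by the resolvent *)

Section resolvent_bounds.
Context (R : realType) (E : completeMetricType R).
Local Notation leb := (@lebesgue_measure R).
Local Notation D := (`[0%R, +oo[%classic : set R).
Local Notation J G t := (\int[leb]_(s in `[0%R, t]) G s)%R.

Lemma Cb_bounded (f : E -> R) : Cb R E f ->
  continuous f /\ exists K : R, forall y, `|f y| <= K.
Proof.
move=> [cf [M [_ fM]]]; split => //; exists (M + 1) => y.
by apply: fM => //; rewrite ltrDl.
Qed.

Lemma measurable_borelC1 (x : E) : measurable (~` [set x] : set (borel E)).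
Proof.
apply: sub_sigma_algebra; rewrite openC.
apply: accessible_closed_set1; apply: hausdorff_accessible.
exact: metric_hausdorff.
Qed.

(** The starting point is observed at every time, so absolute continuity up to a single time [t]
    suffices to transfer the almost sure start at [x] from [P] to [Q]. *)
Lemma measurable_start (t : R) (x : E) : 0 <= t ->
  measurable ([set X : skorokhod E | X 0 <> x] : set (filtration E t)).
Proof.
move=> t0; apply: sub_sigma_algebra.
exists 0; first by rewrite /= in_itv/= lexx.
by exists (~` [set x]); [exact: measurable_borelC1|rewrite setTI].
Qed.

Lemma mean_start (Q : probability (skorokhod E) R) (f : E -> R) (x : E) :
  continuous f -> Q [set X : skorokhod E | X 0 <> x] = 0%E ->
  mean Q f 0 = f x.
Proof.
move=> cf Q0; have mS : measurable [set X : skorokhod E | X 0 <> x].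
  exact: (measurable_funPTI (forget 0) (measurable_start x (lexx 0))).
rewrite /mean /Rintegral (@ae_eq_integral _ _ _ _ _ (cst (f x)%:E))//.
- rewrite integral_cst// [X in (_ * X)%E](_ : _ = 1%E) ?mule1//.
  exact: probability_setT.
- by apply/measurable_EFinP; exact: measurable_comp_path.
- exists [set X : skorokhod E | X 0 <> x]; split => // X /=.
  by move=> /not_implyP[_] fX Xx; apply: fX; rewrite Xx.
Qed.

Variables (P : probability (skorokhod E) R) (x : E) (f g : E -> R).
Variables (Kf Kg lambda : R) (tau : probability (measurableTypeR R) R).
Hypothesis lambda0 : 0 < lambda.
Hypothesis tauE : tau = exponential_prob lambda^-1 :> (set R -> \bar R).
Hypotheses (cf : continuous f) (cg : continuous g).
Hypothesis fK : forall y, `|f y| <= Kf.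
Hypothesis gK : forall y, `|g y| <= Kg.
Hypothesis Px : P [set X : skorokhod E | X 0 <> x] = 0%E.

Let phi (t : R) (X : skorokhod E) : R :=
  f (X t) - f (X 0) - time_integral g t X.

Hypothesis mart : martingale P (fun t X => expR (phi t X)).

Let h (y : E) : R := f y - lambda * g y.

Let phi0 X : phi 0 X = 0.
Proof.
by rewrite /phi subrr sub0r /time_integral set_itv1 Rintegral_set1 oppr0.
Qed.

Let phiK t X : 0 <= t -> `|phi t X| <= Kf + Kf + Kg * t.
Proof.
move=> t0; rewrite (le_trans (ler_normB _ _))// lerD//.
  by rewrite (le_trans (ler_normB _ _))// lerD.
exact: normr_time_integral_le.
Qed.

Let integral_phi (Q : probability (skorokhod E) R) (t : R) : 0 <= t ->
  (\int[Q]_X (phi t X)%:E =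
   (mean Q f t - mean Q f 0 - J (mean Q g) t)%:E)%E.
Proof.
move=> t0.
have iu u : Q.-integrable setT (fun X : skorokhod E => (f (X u))%:E).
  exact: (integrable_comp_path _ cf fK).
have iff := @integrableB _ _ _ Q setT measurableT _ _ (iu t) (iu 0).
have ig : Q.-integrable setT (fun X : skorokhod E => (time_integral g t X)%:E).
  apply: (@integrable_probability_bounded _ _ _ _ _ _ (Kg * t)) => //.
    (* Measurability in the path is read off the martingale: [phi t] is adapted, and the time
       integral is recovered from it and two values of [f]. *)
    rewrite (_ : time_integral g t = fun X => f (X t) - f (X 0) - phi t X).
      apply: measurable_funB.
        by apply: measurable_funB; exact: measurable_comp_path.
      apply: measurable_fun_filtration.
      exact: (measurable_exponent mart t0).
    by apply/funext => X; rewrite /phi opprB addrC subrK.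
  by move=> X; exact: normr_time_integral_le.
transitivity (\int[Q]_X
  ((f (X t))%:E - (f (X 0))%:E - (time_integral g t X)%:E))%E => //.
rewrite (integralB _ iff ig)// (integralB _ (iu t) (iu 0))//.
by rewrite (integral_time_integral _ cg gK) !EFinB !(EFin_mean _ cf fK).
Qed.

Let integral_h (Q : probability (skorokhod E) R) (t : R) :
  (\int[Q]_X (h (X t))%:E = (mean Q f t - lambda * mean Q g t)%:E)%E.
Proof.
have i_f : Q.-integrable setT (fun X : skorokhod E => (f (X t))%:E).
  exact: (integrable_comp_path _ cf fK).
have i_g : Q.-integrable setT (fun X : skorokhod E => (g (X t))%:E).
  exact: (integrable_comp_path _ cg gK).
transitivity (\int[Q]_X ((f (X t))%:E - lambda%:E * (g (X t))%:E))%E => //.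
rewrite integralB//; last exact: integrableZl.
by rewrite integralZl// EFinB EFinM (EFin_mean _ cf fK) (EFin_mean _ cg gK).
Qed.

Let value (Q : probability (skorokhod E) R) : \bar R :=
  (\int[tau]_(t in D) ((\int[Q]_X (h (X t))%:E) - entropy_upto t Q P))%E.

(** The comparison is made at each time [t], with the function of [t] built from [G = mean Q g]
    whose average against [tau] is exactly [f x]. *)
Lemma resolvent_upper_bound Q : (value Q <= (f x)%:E)%E.
Proof.
have [_ <-] := integral_exponential_prob_resolvent lambda0 tauE (f x)
  (measurable_mean Q cg gK) (normr_mean_le Q cg gK).
apply: le_integral_nonmeasurable => t /=; rewrite in_itv/= andbT => t0.
(* Without absolute continuity the entropy is [+oo] and the integrand is [-oo], so the bound at this
   [t] is trivial. *)
have [QP|nQP] :=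
    pselect (distribution Q (forget t) `<< distribution P (forget t));
  last by rewrite /entropy_upto /relative_entropy asboolF//= addeNy leNye.
have Q0 : Q [set X : skorokhod E | X 0 <> x] = 0%E.
  by move/null_content_dominatesP : QP => /(_ _ (measurable_start x t0)); exact.
have := entropy_upto_ge mart phi0 phiK t0 QP.
rewrite integral_phi// integral_h (mean_start cf Q0) => SQ.
apply: le_trans (leeB (lexx _) SQ) _.
rewrite -EFinB lee_fin.
by set a := mean Q f t; set b := mean Q g t; set c := J _ _; lra.
Qed.

(** The tilted measure attains the upper bound at times up to [T]. At a later time [t] the error is
    [mean Q f t - mean Q f T - lambda * mean Q g t], of absolute value at most
    [Kf + Kf + lambda * Kg]; the exponential factor is the mass that [tau] gives to these times. *)
Lemma resolvent_lower_bound (T : R) : 0 <= T ->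
  exists Q,
    ((f x - (Kf + Kf + lambda * Kg) * expR (- lambda^-1 * T))%:E <= value Q)%E.
Proof.
move=> T0; have [Q [QP SQ]] := exists_tilted_probability mart phi0 phiK T0.
have Q0 : Q [set X : skorokhod E | X 0 <> x] = 0%E.
  move/null_content_dominatesP : QP; apply => //.
  exact: (measurable_funPTI (forget 0) (measurable_start x (lexx 0))).
(* Cutting [mean Q g] off after [T] freezes [J G] at its value at [T], just as the entropy of [Q] is
   constant from there on; the averaging identity is then applied to [G]. *)
exists Q; pose G := mean Q g \_ (`]-oo, T]%classic : set R).
have mG : measurable_fun [set: R] G.
  apply/(measurable_restrictT _ _).1; first exact: measurable_itv.
  exact: measurable_funTS (measurable_mean Q cg gK).
have Kg0 : 0 <= Kg by exact: le_trans (normr_ge0 _) (gK x).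
have GK s : `|G s| <= Kg.
  by rewrite /G patchE; case: ifP; rewrite ?normr0// (normr_mean_le Q cg gK).
have JG t : J G t = J (mean Q g) (Num.min t T).
  rewrite /G -Rintegral_mkcondr; congr Rintegral.
  apply/seteqP; split=> s /=; rewrite !in_itv/= le_min.
    by move=> [/andP[-> ->] ->].
  by move=> /and3P[-> -> ->].
have [iU UE] := integral_exponential_prob_resolvent lambda0 tauE (f x) mG GK.
set C := Kf + Kf + lambda * Kg.
have Kf0 : 0 <= Kf by exact: le_trans (normr_ge0 _) (fK x).
have C0 : 0 <= C by rewrite !addr_ge0// mulr_ge0// ltW.
have mT : measurable (`]T, +oo[%classic : set R) by exact: measurable_itv.
have iC : tau.-integrable D
    (fun t => (C * \1_(`]T, +oo[%classic : set R) t)%:E).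
  apply: (@integrable_probability_bounded _ _ _ _ _ _ `|C|) => //.
    by apply: measurable_funM => //; exact: measurable_indic.
  move=> t; rewrite normrM ler_piMr// indicE.
  by case: (_ \in _); rewrite ?normr1 ?normr0.
apply: (@le_trans _ _ (\int[tau]_(t in D) ((f x - lambda * G t + J G t)%:E
    - (C * \1_(`]T, +oo[%classic : set R) t)%:E))%E).
  rewrite (integralB _ iU iC)// [X in (_ <= X - _)%E]UE EFinB leeB//.
  under eq_integral do rewrite EFinM.
  rewrite ge0_integralZl//= ?lee_fin//; last first.
    by apply: measurable_funTS; apply/measurable_EFinP; exact: measurable_indic.
  rewrite integral_indic//= (_ : _ `&` _ = `]T, +oo[%classic).
    by rewrite (exponential_prob_tail_oy tauE T0) -EFinM.
  apply/seteqP; split=> t /=; rewrite !in_itv/= !andbT; first by case.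
  by move=> Tt; split => //; rewrite (le_trans T0)// ltW.
apply: le_integral_nonmeasurable => t /=; rewrite in_itv/= andbT => t0.
rewrite integral_h SQ// integral_phi ?le_min ?t0// (mean_start cf Q0) JG.
rewrite -!EFinB lee_fin indicE; have [tT|Tt] := leP t T.
  rewrite memNset/= ?in_itv/= ?andbT; last by apply/negP; rewrite -leNgt.
  have -> : G t = mean Q g t by rewrite /G patchE mem_set//= in_itv.
  by set a := mean Q f t; set b := mean Q g t; set c := J _ _; lra.
rewrite mem_set/= ?in_itv/= ?andbT//.
have -> : G t = 0.
  by rewrite /G patchE memNset//= in_itv/=; apply/negP; rewrite -ltNge.
have := normr_mean_le Q cf fK t; have := normr_mean_le Q cf fK T.
have : lambda * mean Q g t <= lambda * Kg.
  by rewrite ler_pM2l// (le_trans (ler_norm _))// (normr_mean_le Q cg gK).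
rewrite !ler_norml /C; set a := mean Q f t; set b := lambda * mean Q g t.
set c := J _ _; set d := mean Q f T; set e := lambda * Kg; lra.
Qed.

End resolvent_bounds.

Theorem proposition6p2 (R : realType) (E : completeMetricType R)
    (sepE : separable E)
    (A : set ((E -> R) * (E -> R))) (linA : linear_operator A)
    (wpA : well_posed A)
    (P : E -> probability (skorokhod E) R)
    (solP : forall x : E, solves A (P x) (@dirac _ (borel E) x R))
    (contP : continuous (P : E -> weak_prob E))
    (H : set ((E -> R) * (E -> R))) (HCb : H `<=` Cb R E `*` Cb R E)
    (martH : forall f g, H (f, g) -> forall x : E,
      martingale (P x)
        (fun t X => expR (f (X t) - f (X 0) - time_integral g t X))) :
  forall (lambda : R) (x : E) (f g : E -> R), 0 < lambda -> H (f, g) ->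
    resolvent P lambda (fun y => f y - lambda * g y) x = (f x)%:E.
Proof.
move=> lambda x f g lambda0 Hfg; have := HCb _ Hfg.
move=> [/= /Cb_bounded[cf [Kf fK]] /Cb_bounded[cg [Kg gK]]].
have rate0 : 0 < lambda^-1 by rewrite invr_gt0.
have [tau tauE] := exponential_probability rate0.
have Px : P x [set X : skorokhod E | X 0 <> x] = 0%E.
  have [/(_ (~` [set x])) + _] := solP x.
  rewrite (_ : _ @^-1` _ = [set X : skorokhod E | X 0 <> x])// => ->.
      by rewrite -[LHS]/((\1_[set~ x] x)%:E) indicE memNset//= => /(_ erefl).
  exact: measurable_borelC1.
have mart := martH _ _ Hfg x.
rewrite /resolvent -tauE; apply/eqP; rewrite eq_le; apply/andP; split.
  apply: ge_ereal_sup => _ [Q _ <-].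
  exact: (resolvent_upper_bound lambda0 tauE cf cg fK gK Px mart).
pose C := Kf + Kf + lambda * Kg.
have Kf0 : 0 <= Kf by exact: le_trans (normr_ge0 _) (fK x).
have Kg0 : 0 <= Kg by exact: le_trans (normr_ge0 _) (gK x).
have C0 : 0 <= C by rewrite !addr_ge0// mulr_ge0// ltW.
apply/lee_addgt0Pr => e e0.
(* With [T = lambda * (C / e)] the error [C * expR (- lambda^-1 * T)] becomes
   [C * expR (- (C / e))], which is at most [e] because [1 + C / e <= expR (C / e)]. *)
have T0 : 0 <= lambda * (C / e) by rewrite mulr_ge0 ?divr_ge0// ltW.
have [Q QT] := resolvent_lower_bound lambda0 tauE cf cg fK gK Px mart T0.
rewrite -leeBlDr//.
apply: (@le_trans _ _ _ _ _ _ (ereal_sup_ubound _)); last by exists Q.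
apply: le_trans QT; rewrite -EFinB lee_fin lerD2l lerN2 -/C.
rewrite mulNr mulKf ?gt_eqF// expRN ler_pdivrMr ?expR_gt0//.
rewrite (le_trans _ (ler_wpM2l (ltW e0) (expR_ge1Dx (C / e))))//.
by rewrite mulrDr mulr1 mulrCA mulfV ?gt_eqF// mulr1 lerDr ltW.
Qed.
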